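(* Let $(x_s)_{s\in S}$ be a normalized family in a Banach space $X$ (i.e. $\|x_s\|=1$ for all $s\in S$) such that for every chain $\beta\in\mathcal{C}(S)$, the sequence $(x_s)_{s\in\beta}$ is Schauder basic. Then there exists a subtree $T$ of $S$ such that either (1) for every chain $\beta\in\mathcal{C}(T)$, the sequence $(x_s)_{s\in\beta}$ is semi-boundedly complete; or (2) for no chain $\beta\in\mathcal{C}(T)$ is the sequence $(x_s)_{s\in\beta}$ semi-boundedly complete.
   Context: $S=\bigcup_{n=0}^\infty\{0,1\}^n$ is the dyadic tree of all finite sequences in $\{0,1\}$ (including the empty one), partially ordered by the initial segment relation $\le$. A subtree of $S$ is a subset $T\subseteq S$, with the induced order, which has a single minimal element and in which every element has exactly two immediate successors (i.e. for each $t\in T$ there are exactly two minimal elements of $\{t'\in T: t<t'\}$); thus $T$ is order isomorphic to $S$. A chain of a tree $T$ is an infinite linearly ordered subset of $T$; $\mathcal{C}(T)$ is the set of all chains of $T$. For a chain $\beta$ with elements enumerated increasingly as $s_1<s_2<\cdots$, $(x_s)_{s\in\beta}$ denotes the sequence $(x_{s_i})_{i=1}^\infty$. A normalized Schauder basic sequence $(e_i)$ is semi-boundedly complete if for every $(\lambda_i)\in\mathbb{R}^{\mathbb{N}}$, $\sup_n\|\sum_{i=1}^n\lambda_ie_i\|<+\infty$ implies $\lim_{n\to\infty}\lambda_n=0$. *)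

(* Defs.v *)
From HB Require Import structures.
From mathcomp Require Import all_boot all_order all_algebra.
From mathcomp Require Import all_classical all_reals all_analysis.

Set Implicit Arguments.
Unset Strict Implicit.
Unset Printing Implicit Defensive.

Import Order.TTheory GRing.Theory Num.Theory.
Import numFieldNormedType.Exports.

Local Open Scope classical_set_scope.
Local Open Scope ring_scope.

Notation dyadic := (seq bool).

Definition strict_prefix (s t : dyadic) : bool := (s != t) && prefix s t.

Definition minimals (A : set dyadic) : set dyadic :=
  [set m | A m /\ forall t, A t -> ~~ strict_prefix t m].

Definition immediate_successors (T : set dyadic) (t : dyadic) : set dyadic :=
  minimals [set t' | T t' /\ strict_prefix t t'].

Definition subtree (T : set dyadic) : Prop :=
  (exists m, minimals T = [set m]) /\
  (forall t, T t ->
     exists a b, a != b /\ immediate_successors T t = [set a; b]).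

Definition chain (T beta : set dyadic) : Prop :=
  [/\ beta `<=` T, infinite_set beta & total_on beta (fun s t => prefix s t)].

Definition enumerates (beta : set dyadic) (s : nat -> dyadic) : Prop :=
  {homo s : i j / (i < j)%N >-> strict_prefix i j} /\ range s = beta.

(* Default value if [beta] is not infinite and linearly ordered; for chains see
   [chain_enumP] and [enumerates_inj]. *)
Definition chain_enum (beta : set dyadic) : nat -> dyadic :=
  xget (fun=> [::]) (enumerates beta).

Lemma strict_prefix_size s t : strict_prefix s t -> (size s < size t)%N.
Proof.
move=> /andP[sNt st]; rewrite ltn_neqAle size_prefix// andbT.
apply: contra sNt => /eqP st_size; move: st.
by rewrite prefixE st_size take_size eq_sym.
Qed.

Lemma prefix_strict s t :
  prefix s t -> (size s < size t)%N -> strict_prefix s t.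
Proof.
move=> st ltst; rewrite /strict_prefix st andbT.
by apply: contraTneq ltst => ->; rewrite ltnn.
Qed.

Lemma enumerates_inj beta s s' :
  enumerates beta s -> enumerates beta s' -> s = s'.
Proof.
have key u v : enumerates beta u -> enumerates beta v ->
    forall n, (size (u n) <= size (v n))%N.
  move=> [uinc ur] [vinc vr] n.
  have usz i j : (i < j)%N -> (size (u i) < size (u j))%N.
    by move=> /uinc/strict_prefix_size.
  have vsz i j : (i < j)%N -> (size (v i) < size (v j))%N.
    by move=> /vinc/strict_prefix_size.
  have /choice[f fE] : forall i, exists j, u j = v i.
    move=> i; have : range u (v i) by rewrite ur -vr; exists i.
    by case=> j _ <-; exists j.
  have fmono i j : (i < j)%N -> (f i < f j)%N.
    move=> ij; rewrite ltnNge leq_eqVlt; apply/negP => /orP[/eqP e|/usz].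
      by move: (vsz _ _ ij); rewrite -!fE e ltnn.
    by rewrite !fE ltnNge ltnW// vsz.
  have nf : (n <= f n)%N.
    by elim: n => // n IH; exact: leq_ltn_trans IH (fmono _ _ (ltnSn n)).
  by rewrite -fE; move: nf; rewrite leq_eqVlt => /orP[/eqP <-//|/usz/ltnW].
move=> es es'; apply/funext => n.
have sz : size (s n) = size (s' n) by apply/eqP; rewrite eqn_leq !key.
have : range s (s' n) by case: es => _ ->; case: es' => _ <-; exists n.
move=> [m _ e]; rewrite -e; congr s; move: sz; rewrite -e.
case: es => sinc _.
by case: (ltngtP n m) => // /sinc/strict_prefix_size => [h|h] e'; move: h; rewrite e' ltnn.
Qed.

Lemma enumerates_ex T beta : chain T beta -> exists s, enumerates beta s.
Proof.
move=> [_ binf btot].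
have unbounded n : exists2 t, beta t & (n < size t)%N.
  apply: contrapT => /forall2NP H; apply: binf.
  apply: (@sub_finite_set _ _ [set` flatten [seq
     [seq tval t | t <- enum {: i.-tuple bool}] | i <- iota 0 n.+1]]);
    last exact: finite_seq.
  move=> t bt; apply/flattenP.
  exists [seq tval u | u <- enum {: (size t).-tuple bool}].
    apply/mapP; exists (size t) => //; rewrite mem_iota leq0n add0n ltnS leqNgt.
    by apply/negP; case: (H t).
  by apply/mapP; exists (in_tuple t); rewrite // mem_enum.
have strict s t : beta s -> beta t -> (size s < size t)%N -> strict_prefix s t.
  move=> bs bt lst; case: (btot s t bs bt) => [st|ts]; first exact: prefix_strict.
  by move: (size_prefix ts); rewrite leqNgt lst.
have eq_size s t : beta s -> beta t -> size s = size t -> s = t.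
  move=> bs bt e; case: (btot s t bs bt); rewrite prefixE.
    by rewrite e take_size => /eqP.
  by rewrite -e take_size => /eqP.
have least n : exists t, [/\ beta t, (n <= size t)%N &
    forall u, beta u -> (n <= size u)%N -> (size t <= size u)%N].
  have ex : exists k, `[< exists t, [/\ beta t, (n <= size t)%N & size t = k] >].
    have [t bt nt] := unbounded n.
    by exists (size t); apply/asboolP; exists t; split=> //; exact: ltnW.
  case: (ex_minnP ex) => k /asboolP[t [bt nt tk]] kmin.
  exists t; split=> // u bu nu; rewrite tk; apply: kmin; apply/asboolP.
  by exists u.
have /choice[g gP] := least.
pose s := fix s n := if n is m.+1 then g (size (s m)).+1 else g 0%N.
have bg k : beta (g k) by case: (gP k).
have bs n : beta (s n) by case: n => [|n] /=; exact: bg.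
have sS n : (size (s n) < size (s n.+1))%N.
  by rewrite /=; case: (gP (size (s n)).+1).
have slt : {homo s : i j / (i < j)%N >-> (size i < size j)%N}.
  move=> i; elim=> // j IH; rewrite ltnS leq_eqVlt => /orP[/eqP -> //|/IH h].
  exact: ltn_trans h (sS j).
exists s; split.
  by move=> i j /slt; apply: strict.
apply/seteqP; split=> [_ [n _ <-]//|b bb].
have sge n : (n <= size (s n))%N.
  by elim: n => // n IH; exact: leq_ltn_trans IH (sS n).
have ex : exists n, (size b <= size (s n))%N by exists (size b).
case: (ex_minnP ex) => n bn nmin; exists n => //; apply: eq_size => //.
apply/eqP; rewrite eqn_leq bn andbT.
case: n bn nmin => [|n] bn nmin; first by case: (gP 0%N) => _ _; apply.
have ltb : (size (s n) < size b)%N.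
  by rewrite ltnNge; apply/negP => /nmin; rewrite ltnn.
by case: (gP (size (s n)).+1) => _ _; apply.
Qed.

Lemma chain_enumP T beta : chain T beta -> enumerates beta (chain_enum beta).
Proof. by move=> /enumerates_ex[s es]; exact: (xgetPex _ (ex_intro _ s es)). Qed.

Definition along (V : Type) (x : dyadic -> V) (beta : set dyadic) : nat -> V :=
  fun i => x (chain_enum beta i).

Section Sequences.
Variables (R : realType) (X : completeNormedModType R).
Implicit Types e : nat -> X.

Definition closed_span e : set X :=
  closure [set v | exists n (a : nat -> R), v = \sum_(0 <= i < n) a i *: e i].

(* [e] is a Schauder basis of its closed linear span. *)
Definition schauder_basic e : Prop :=
  forall v, closed_span e v ->
    exists! a : nat -> R, series (fun i => a i *: e i) @ \oo --> v.

Definition semi_boundedly_complete e : Prop :=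
  [/\ forall i, `|e i| = 1,
      schauder_basic e &
      forall lambda : nat -> R,
        (ereal_sup (range (fun n => `|\sum_(0 <= i < n.+1) lambda i *: e i|%:E))
           < +oo)%E ->
        lambda @ \oo --> (0 : R)].

End Sequences.

(* Main.v *)
(* The sequence along a chain fails to be semi-boundedly complete exactly
   when, for some infinite set K of nodes of the chain, each finite initial part
   of the chain carries coefficients with partial sums of norm at most 1 and
   coefficients on K bounded away from 0: a compactness argument glues these
   finite solutions together, the coefficients being bounded by 2. Hence the set
   of failing chains is analytic, and Stern's Ramsey theorem for analytic sets of
   chains applies. The latter is proved by fusion of perfect sets of nodes (every
   element has two incomparable extensions in the set) and combinatorial forcing,
   first for open sets of chains and then, through pairs (chain, infinite subset
   of it), for analytic sets. *)
Require Import Defs.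
From HB Require Import structures.
From mathcomp Require Import all_boot all_order all_algebra.
From mathcomp Require Import all_classical all_reals all_analysis.

Set Implicit Arguments.
Unset Strict Implicit.
Unset Printing Implicit Defensive.

Import Order.TTheory GRing.Theory Num.Theory.
Import numFieldNormedType.Exports.

Local Open Scope classical_set_scope.
Local Open Scope ring_scope.

(** * Prefix order on dyadic sequences *)

Lemma strict_prefixW (s t : dyadic) : strict_prefix s t -> prefix s t.
Proof. by case/andP. Qed.

Lemma strict_prefixE (s t : dyadic) :
  strict_prefix s t = prefix s t && (size s < size t)%N.
Proof.
apply/idP/andP => [h|[]]; last exact: prefix_strict.
by split; [exact: strict_prefixW|exact: strict_prefix_size].
Qed.

Lemma strict_prefixxx s : strict_prefix s s = false.
Proof. by rewrite strict_prefixE ltnn andbF. Qed.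

Lemma strict_prefix_prefix_trans (s t u : dyadic) :
  strict_prefix s t -> prefix t u -> strict_prefix s u.
Proof.
rewrite !strict_prefixE => /andP[st lst] tu.
by rewrite (prefix_trans st tu) (leq_trans lst (size_prefix tu)).
Qed.

Lemma prefix_strict_prefix_trans (s t u : dyadic) :
  prefix s t -> strict_prefix t u -> strict_prefix s u.
Proof.
rewrite !strict_prefixE => st /andP[tu ltu].
by rewrite (prefix_trans st tu) (leq_ltn_trans (size_prefix st) ltu).
Qed.

Lemma strict_prefix_trans (s t u : dyadic) :
  strict_prefix s t -> strict_prefix t u -> strict_prefix s u.
Proof. by move=> st /strict_prefixW; exact: strict_prefix_prefix_trans. Qed.

Lemma strict_prefix_asym (s t : dyadic) : strict_prefix s t -> ~~ prefix t s.
Proof.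
by move=> /strict_prefix_size; rewrite ltnNge; apply: contra => /size_prefix.
Qed.

Lemma strict_prefix_rcons (s : dyadic) b : strict_prefix s (rcons s b).
Proof. by rewrite strict_prefixE prefix_rcons size_rcons/=. Qed.

Lemma prefix_eqVstrict (s t : dyadic) : prefix s t -> s = t \/ strict_prefix s t.
Proof.
by case: (eqVneq s t) => [->|sNt st]; [left|right; rewrite /strict_prefix sNt].
Qed.

Lemma prefix_total (s t u : dyadic) :
  prefix s u -> prefix t u -> prefix s t \/ prefix t s.
Proof.
move=> /prefixP[s' ->]; rewrite !prefixE.
case: (leqP (size s) (size t)) => h /eqP e; [left|right].
  by rewrite -e take_takel// take_size_cat.
by rewrite -[X in _ == X]e take_cat h.
Qed.

Lemma incomparableF (s t u : dyadic) :
  ~~ prefix s t -> ~~ prefix t s -> prefix s u -> prefix t u -> False.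
Proof. by move=> /negP st /negP ts su /(prefix_total su)[]. Qed.

(** * Perfect sets of nodes *)

Definition above (t : dyadic) : set dyadic := [set u | strict_prefix t u].

Definition below (t : dyadic) : set dyadic := [set u | prefix u t].

(** Weaker than being a subtree: the two extensions need not be immediate, and there may be more of
    them. This makes the notion stable under cones and dense subsets. *)
Definition perfect (D : set dyadic) : Prop :=
  D !=set0 /\ forall t, D t -> exists a b,
    [/\ (D `&` above t) a, (D `&` above t) b, ~~ prefix a b & ~~ prefix b a].

Lemma perfectT : perfect setT.
Proof.
split; first by exists [::].
move=> t _; exists (rcons t true), (rcons t false).
by rewrite /above/= !strict_prefix_rcons !prefixE !size_rcons;
  split=> //; rewrite take_oversize ?size_rcons// eqseq_rcons andbF.
Qed.

(** Two incomparable extensions in [D] of a node of [A] can be prolonged into [A], and prolongations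
    of incomparable nodes stay incomparable. *)
Lemma perfect_dense (D : set dyadic) (t : dyadic) (A : set dyadic) :
  perfect D -> D t -> A `<=` D ->
  (forall u, D u -> prefix t u -> exists2 v, A v & prefix u v) ->
  perfect (A `&` [set u : dyadic | prefix t u]).
Proof.
move=> [_ pD] Dt AD h; split.
  by have [v Av tv] := h t Dt (prefix_refl t); exists v.
move=> u [Au tu]; have [a [b [[Da ua] [Db ub] ab ba]]] := pD u (AD _ Au).
have [a' Aa' aa'] := h a Da (prefix_trans tu (strict_prefixW ua)).

have [b' Ab' bb'] := h b Db (prefix_trans tu (strict_prefixW ub)).
exists a', b'.
have ua' := strict_prefix_prefix_trans ua aa'.
have ub' := strict_prefix_prefix_trans ub bb'.
split; first by split=> //; split=> //; exact: prefix_trans tu (strict_prefixW _).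
- by split=> //; split=> //; exact: prefix_trans tu (strict_prefixW _).
- apply/negP => a'b'.
  exact: incomparableF ab ba (prefix_trans aa' a'b') bb'.
- apply/negP => b'a'.
  exact: incomparableF ab ba aa' (prefix_trans bb' b'a').
Qed.

Lemma perfect_cone D t :
  perfect D -> D t -> perfect (D `&` [set u : dyadic | prefix t u]).
Proof.
move=> pD Dt; apply: (perfect_dense pD Dt) => // u Du _.
by exists u => //; exact: prefix_refl.
Qed.

Lemma perfect_above D t : perfect D -> D t -> perfect (D `&` above t).
Proof.
move=> pD Dt.
rewrite (_ : _ `&` _ = (D `&` above t) `&` [set u : dyadic | prefix t u]); last first.
  apply/seteqP; split=> [u [Du tu]|u []//]; split=> //.
  exact: strict_prefixW.
apply: (perfect_dense pD Dt) => [u []//|u Du tu].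
have [a [_ [[Da ua] _ _ _]]] := pD.2 u Du.
exists a; last exact: strict_prefixW.
by split=> //; exact: prefix_strict_prefix_trans ua.
Qed.

(** Either [A] is dense in [D] above some node, and its trace there is perfect, or some cone of [D]
    misses [A]. *)
Lemma perfect_pigeonhole (A D : set dyadic) : perfect D ->
  exists D', [/\ D' `<=` D, perfect D' & D' `<=` A \/ D' `<=` ~` A].
Proof.
move=> pD.
have [[t Dt h]|nd] := pselect (exists2 t, D t &
    forall u, D u -> prefix t u -> exists2 v, (A `&` D) v & prefix u v).
  exists ((A `&` D) `&` [set u : dyadic | prefix t u]); split.
  - by move=> u [[]].
  - by apply: (perfect_dense pD Dt) => // u [].
  - by left=> u [[]].
have [t Dt] := pD.1.
have [u [Du tu hu]] : exists u, [/\ D u, prefix t u &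
    forall v, D v -> prefix u v -> ~ A v].
  apply: contrapT => hu; apply: nd; exists t => // u Du tu.
  apply: contrapT => hv; apply: hu; exists u; split=> // v Dv uv Av.
  by apply: hv; exists v.
exists (D `&` [set v | prefix u v]); split; first by move=> v [].
  exact: perfect_cone.
by right=> v [Dv uv]; apply: hu.
Qed.

(** * Subtrees and fusion *)

Lemma range_subtree (phi : dyadic -> dyadic) :
  (forall s t, strict_prefix (phi s) (phi t) = strict_prefix s t) ->
  subtree (range phi).
Proof.
move=> phiE.
have phi_inj : injective phi.
  move=> s t e.
  (* If [phi u = phi v], then [u] lies strictly below the children of [v], hence is a prefix of
     [v]. *)
  have key u v : phi u = phi v -> prefix u v.
    move=> euv; have : strict_prefix u (rcons v true).
      by rewrite -phiE euv phiE strict_prefix_rcons.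
    have : strict_prefix u (rcons v false).
      by rewrite -phiE euv phiE strict_prefix_rcons.
    rewrite !strict_prefixE => /andP[+ lu] _; rewrite size_rcons ltnS in lu.
    by rewrite !prefixE -cats1 takel_cat.
  have st := key _ _ e; have ts := key _ _ (esym e).
  by case: (prefix_eqVstrict st) => // /strict_prefix_asym; rewrite ts.
split.
  exists (phi [::]); apply/seteqP; split=> [_ [[s _ <-] h]|_ ->].
    have := h (phi [::]) (ex_intro2 _ _ [::] I erefl).
    rewrite phiE; case: s {h} => //.
  split; first by exists [::].
  by move=> _ [s _ <-]; rewrite phiE strict_prefixE ltn0 andbF.
move=> _ [s _ <-]; exists (phi (rcons s true)), (phi (rcons s false)); split.
  by apply/eqP => /phi_inj/eqP; rewrite eqseq_rcons andbF.
apply/seteqP; split=> [_ [[[t _ <-]]]|].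
  rewrite phiE => st h.
  have /prefixP[[|b t'] e] := strict_prefixW st.
    by move: st; rewrite e cats0 strict_prefixxx.
  have st' : prefix (rcons s b) t by rewrite e -cat_rcons prefix_prefix.
  have [<-|] := prefix_eqVstrict st'; first by case: b {e st'}; [left|right].
  rewrite -phiE => h'.
  have := h (phi (rcons s b)); rewrite h' => /(_ _)/negP[]//.
  by split; [exists (rcons s b)|rewrite phiE strict_prefix_rcons].
have key b : immediate_successors (range phi) (phi s) (phi (rcons s b)).
  split; first by split;
    [exists (rcons s b)|rewrite phiE strict_prefix_rcons].
  move=> _ [[t _ <-]]; rewrite !phiE !strict_prefixE size_rcons.
  by move=> /andP[_ h]; rewrite ltnS leqNgt h andbF.
by move=> _ [->|->]; exact: key.
Qed.

(* The requirement attached to a node [t] of the tree constructed by fusion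
   only involves the part of the tree above [t]. *)
Lemma fusion (P : dyadic -> set dyadic -> Prop) (D : set dyadic) :
  (forall t A B, A `<=` B -> P t B -> P t A) ->
  (forall t E, D t -> perfect E -> E `<=` D `&` above t ->
     exists E', [/\ E' `<=` E, perfect E' & P t E']) ->
  perfect D ->
  exists T, [/\ T `<=` D, perfect T, subtree T &
    forall t, T t -> P t (T `&` above t)].
Proof.
move=> antiP denseP pD.
(* One step of the fusion: choose a root in [E], shrink the part of [E] above it to meet the root's
   requirement, and split the result into two incomparable cones. *)
have /choice[f fP] : forall E, exists x : dyadic * (set dyadic * set dyadic),
    perfect E /\ E `<=` D ->
    [/\ E x.1, perfect x.2.1 /\ x.2.1 `<=` E `&` above x.1,
      perfect x.2.2 /\ x.2.2 `<=` E `&` above x.1,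
      (forall a b, x.2.1 a -> x.2.2 b -> ~~ prefix a b /\ ~~ prefix b a) &
      P x.1 (x.2.1 `|` x.2.2)].
  move=> E; have [[pE ED]|nE] := pselect (perfect E /\ E `<=` D); last first.
    by exists ([::], (setT, setT)).
  have [t Et] := pE.1.
  have [E' [E'E pE' PE']] : exists E',
      [/\ E' `<=` E `&` above t, perfect E' & P t E'].
    apply: denseP; [exact: ED|exact: perfect_above|].
    by move=> u [Eu tu]; split=> //; exact: ED.
  have [u E'u] := pE'.1.
  have [a [b [[E'a ua] [E'b ub] ab ba]]] := pE'.2 u E'u.
  exists (t, (E' `&` [set v | prefix a v], E' `&` [set v | prefix b v])).
  move=> _; split=> //=.
  - by split; [exact: perfect_cone|move=> v [/E'E]].
  - by split; [exact: perfect_cone|move=> v [/E'E]].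
  - move=> v w [_ av] [_ bw]; split; apply/negP => vw.
      exact: incomparableF ab ba (prefix_trans av vw) bw.
    exact: incomparableF ab ba av (prefix_trans bw vw).
  - by apply: antiP PE' => v [[]|[]].
pose child (E : set dyadic) (c : bool) := if c then (f E).2.1 else (f E).2.2.
(* [phi E s] is the root chosen in the set reached from [E] by taking the turns [s]. *)
pose phi E s := (f (foldl child E s)).1.
pose good E := perfect E /\ E `<=` D.
have good_child E c : good E -> good (child E c) /\ child E c `<=` E `&` above (f E).1.
  move=> gE; have [_ [p1 s1] [p2 s2] _ _] := fP _ gE.
  by case: c; split=> //; split=> // u /=; [move/s1|move/s2] => -[/gE.2].
have good_foldl s : forall E, good E -> good (foldl child E s) /\ foldl child E s `<=` E.
  elim: s => [|c s IH] E gE; first by split=> /= [|u].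
  rewrite /=.
  have [gc sc] := good_child E c gE; have [gf sf] := IH _ gc.
  by split=> // u /sf/sc[].
have phi_in E s : good E -> E (phi E s).
  move=> gE; have [gf sf] := good_foldl s E gE.
  by have [/sf] := fP _ gf.
have phi_above E c s : good E -> strict_prefix (phi E [::]) (phi E (c :: s)).
  move=> gE; have [gc sc] := good_child E c gE.
  by have /sc[] := phi_in _ s gc.
have phi_incomp E c d s t : good E -> c != d ->
    ~~ prefix (phi E (c :: s)) (phi E (d :: t)).
  move=> gE cd; have [_ _ _ h _] := fP _ gE.
  have /= := phi_in _ s (good_child E c gE).1.
  have /= := phi_in _ t (good_child E d gE).1.
  move: c d cd => [] [] // _ /= h1 h2.
    by have [] := h _ _ h2 h1.
  by have [] := h _ _ h1 h2.
have phiE E s t : good E -> strict_prefix (phi E s) (phi E t) = strict_prefix s t.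
  elim: s t E => [|c s IH] [|d t] E gE.
  - by rewrite !strict_prefixxx.
  - by rewrite phi_above// strict_prefixE prefix0s.
  - rewrite [RHS]strict_prefixE ltn0 andbF.
    apply/negbTE/negP => /(strict_prefix_trans (phi_above _ c s gE)).
    by rewrite strict_prefixxx.
  - have [<-|cd] := eqVneq c d.
      rewrite [RHS]strict_prefixE prefix_cons eqxx/= ltnS -strict_prefixE.
      exact: IH (good_child E c gE).1.
    rewrite [RHS]strict_prefixE prefix_cons (negbTE cd)/=.
    by apply/negbTE/negP => /strict_prefixW; exact/negP/phi_incomp.
have gD : good D by split.
exists (range (phi D)); split.
- by move=> _ [s _ <-]; exact: phi_in.
- split; first by exists (phi D [::]), [::].
  move=> _ [s _ <-]; exists (phi D (rcons s true)), (phi D (rcons s false)).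
  have e c : phi D (rcons s c) = phi (foldl child D s) [:: c].
    by rewrite /phi -cats1 foldl_cat.
  have [gs _] := good_foldl s D gD.
  split; last 2 first.
  + by rewrite !e; apply: phi_incomp.
  + by rewrite !e; apply: phi_incomp.
  + by split; [exists (rcons s true)|
      rewrite /above/= phiE// strict_prefix_rcons].
  + by split; [exists (rcons s false)|
      rewrite /above/= phiE// strict_prefix_rcons].
- by apply: range_subtree => s t; exact: phiE.
(* The part of the tree above [phi D s] lies in the union of the two cones chosen at that stage, so
   it inherits the requirement. *)
- move=> _ [s _ <-]; have [gs _] := good_foldl s D gD.
  have [_ _ _ _] := fP _ gs; apply: antiP => _ [[t _ <-]].
  rewrite /above/= phiE// => st.
  have /prefixP[[|c t'] e] := strict_prefixW st.
    by move: st; rewrite e cats0 strict_prefixxx.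
  have e' : phi D t = phi (child (foldl child D s) c) t'.
    by rewrite /phi e foldl_cat.
  have := phi_in _ t' (good_child _ c gs).1.
  by rewrite e'; case: c {e e'} => h; [left|right].
Qed.

(** * Fusion with finitely many requirements at each node *)

(** A prefix of [t] is determined by its length, so a set of prefixes is coded by a set of lengths
    up to [size t]. *)
Lemma finite_subsets_below t : finite_set [set c | c `<=` below t].
Proof.
pose g (A : {set 'I_(size t).+1}) : set dyadic := [set take i t | i in [set` A]].
apply: (@sub_finite_set _ _ (range g)); last exact/finite_image/finite_finset.
move=> c cb; exists [set i : 'I_(size t).+1 | `[< c (take i t) >]]%SET => //.
apply/seteqP; split=> [_ [i /= + <-]|u cu]; first by rewrite inE => /asboolP.
have ut := cb _ cu; have := ut; rewrite /below/= prefixE => /eqP e.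
have lu : (size u < (size t).+1)%N by rewrite ltnS size_prefix.
by exists (Ordinal lu); rewrite //= inE e; apply/asboolP.
Qed.

Lemma finite_below t : finite_set (below t).
Proof.
apply: sub_finite_set (_ : _ `<=` [set take i t | i in `I_(size t).+1]) _.
  move=> u ut; exists (size u); first by rewrite /= ltnS size_prefix.
  by apply/eqP; rewrite -prefixE.
exact/finite_image/finite_II.
Qed.

(** The requirements are met one after another; shrinking the set preserves those already met. *)
Lemma perfect_finite_refine (I : choiceType) (Q : I -> set dyadic -> Prop)
    (L : set I) (D : set dyadic) :
  finite_set L -> (forall i A B, A `<=` B -> Q i B -> Q i A) -> perfect D ->
  (forall i E, L i -> E `<=` D -> perfect E ->
    exists E', [/\ E' `<=` E, perfect E' & Q i E']) ->
  exists E, [/\ E `<=` D, perfect E & forall i, L i -> Q i E].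
Proof.
move=> /finite_seqP[l ->] antiQ pD.
elim: l => [|i l IH] denseQ; first by exists D; split=> // i; rewrite /= in_nil.
have [j E jl|E [ED pE QE]] := IH.
  by apply: denseQ; rewrite /= inE jl orbT.
have [|E' [E'E pE' QE']] := denseQ i E _ ED pE; first by rewrite /= inE eqxx.
exists E'; split=> //; first exact: subset_trans ED.
move=> j /=; rewrite inE => /orP[/eqP -> //|jl].
exact: antiQ E'E (QE j jl).
Qed.

Lemma fusion_family (I : choiceType) (ix : dyadic -> set I)
    (P : dyadic -> I -> set dyadic -> Prop) (D : set dyadic) :
  (forall t, finite_set (ix t)) ->
  (forall t i A B, A `<=` B -> P t i B -> P t i A) ->
  (forall t i E, D t -> ix t i -> perfect E -> E `<=` D `&` above t ->
     exists E', [/\ E' `<=` E, perfect E' & P t i E']) ->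
  perfect D ->
  exists T, [/\ T `<=` D, perfect T, subtree T &
    forall t i, T t -> ix t i -> P t i (T `&` above t)].
Proof.
move=> fin antiP denseP pD.
pose P' t A := forall i, ix t i -> P t i A.
have [t A B AB PB i /PB|t E Dt pE ED||T [TD pT sT PT]] := @fusion P' D.
- exact: antiP.
- apply: perfect_finite_refine => //; first exact: antiP.
  by move=> i E' ti E'E pE'; apply: denseP => //; exact: subset_trans ED.
- exact: pD.
- by exists T; split=> // t i Tt; exact: PT.
Qed.

(** * Initial and final parts of chains *)

Definition upto (b : set dyadic) (s : dyadic) : set dyadic := b `&` below s.

(** Elements of [K] that are not above [s] are comparable with [s], hence among its finitely many
    prefixes. *)
Lemma infinite_above A b s K : chain A b -> b s -> K `<=` b ->
  infinite_set K -> infinite_set (K `&` above s).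
Proof.
move=> [_ _ tot] bs Kb Kinf fin; apply: Kinf.
apply: sub_finite_set (_ : _ `<=` (K `&` above s) `|` below s) _.
  move=> u Ku; have [us|su] := tot u s (Kb _ Ku) bs; first by right.
  by have [<-|su'] := prefix_eqVstrict su; [right; exact: prefix_refl|left].
by rewrite finite_setU; split=> //; exact: finite_below.
Qed.

Lemma chain_above A b s : chain A b -> b s -> chain (A `&` above s) (b `&` above s).
Proof.
move=> cb bs; have [bA binf tot] := cb; split.
- by move=> u [/bA].
- exact: infinite_above cb bs _ binf.
- by move=> u v [bu _] [bv _]; exact: tot.
Qed.

Lemma sub_chain A B b : A `<=` B -> chain A b -> chain B b.
Proof. by move=> AB [bA binf tot]; split=> //; exact: subset_trans AB. Qed.

Lemma uptoU_above A b s : chain A b -> b s -> b = upto b s `|` (b `&` above s).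
Proof.
move=> [_ _ tot] bs; apply/seteqP; split=> [u bu|u [[]|[]]//].
have [us|su] := tot u s bu bs; first by left.
have [<-|su'] := prefix_eqVstrict su; last by right.
by left; split=> //; exact: prefix_refl.
Qed.

Lemma total_min (b : set dyadic) : b !=set0 ->
  total_on b (fun s t => prefix s t) -> exists2 s, b s & forall u, b u -> prefix s u.
Proof.
move=> [t bt] tot.
have ex : exists k, `[< exists2 s, b s & size s = k >].
  by exists (size t); apply/asboolP; exists t.
case: (ex_minnP ex) => k /asboolP[s bs <-] kmin; exists s => // u bu.
have [//|us] := tot s u bs bu.
have [-> |] := prefix_eqVstrict us; first exact: prefix_refl.
move=> /strict_prefix_size; rewrite ltnNge kmin//.
by apply/asboolP; exists u.
Qed.

Lemma upto_min (b : set dyadic) s :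
  b s -> (forall u, b u -> prefix s u) -> upto b s = [set s].
Proof.
move=> bs smin; apply/seteqP; split=> [u [bu us]|_ ->]; last first.
  by split=> //; exact: prefix_refl.
have [//|/strict_prefix_asym] := prefix_eqVstrict us.
by rewrite smin.
Qed.

Lemma upto_below b s : upto b s `<=` below s.
Proof. by move=> u []. Qed.

Lemma uptoU_belowl c b s : c `<=` below s -> b `<=` above s -> upto (c `|` b) s = c.
Proof.
move=> cs bs; apply/seteqP; split=> [u [[//|/bs su] us]|u cu].
  by have := strict_prefix_asym su; rewrite us.
by split; [left|exact: cs].
Qed.

Lemma chain_min A b : chain A b -> exists2 s, b s & forall u, b u -> prefix s u.
Proof. by move=> [_ binf tot]; apply: total_min tot; exact: infinite_setN0. Qed.

(** The predecessor of [s] is the longest element of [b] strictly below [s]; it exists because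
    lengths are bounded by [size s]. *)
Lemma chain_pred A b s : chain A b -> b s ->
  upto b s = [set s] \/
  exists t, [/\ b t, strict_prefix t s & upto b s = upto b t `|` [set s]].
Proof.
move=> [_ _ tot] bs.
have [[t0 bt0]|nb] := pselect (b `&` [set t | strict_prefix t s] !=set0); last first.
  left; apply/seteqP; split=> [u [bu us]|_ ->]; last by split=> //; exact: prefix_refl.
  by have [//|us'] := prefix_eqVstrict us; case: nb; exists u.
right.
have ex : exists k, `[< exists t, [/\ b t, strict_prefix t s & size t = k] >].
  by exists (size t0); apply/asboolP; exists t0; case: bt0.
case: (@ex_maxnP _ (size s) ex) => [k /asboolP[t [_ + <-]]|k /asboolP[t [bt ts <-]] kmax].
  by move=> /strict_prefix_size/ltnW.
exists t; split=> //; apply/seteqP; split=> [u [bu us]|u [[bu ut]|->]].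
- have [->|us'] := prefix_eqVstrict us; [by right|left; split=> //].
  have [//|tu] := tot u t bu bt; rewrite /below/=.
  have [->|] := prefix_eqVstrict tu; first exact: prefix_refl.
  move=> /strict_prefix_size; rewrite ltnNge kmax//.
  by apply/asboolP; exists u.
- by split=> //; exact: prefix_trans ut (strict_prefixW ts).
- by split=> //; exact: prefix_refl.
Qed.

(** * Ramsey theorem for open sets of chains *)

(* Combinatorial forcing. [rej t c] says that no perfect subset of [T1] above
   [t] sends all continuations of the finite chain [c] into the open set; after
   the second fusion rejection propagates along chains, so the open set is
   never entered. *)
Lemma open_ramsey (B : set (set dyadic)) (D : set dyadic) : perfect D ->
  exists D', [/\ D' `<=` D, perfect D' &
    (forall b, chain D' b -> exists2 s, b s & B (upto b s)) \/
    (forall b s, chain D' b -> b s -> ~ B (upto b s))].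
Proof.
move=> pD.
pose hit b := exists2 s, b s & B (upto b s).
pose acc c A := forall b, chain A b -> hit (c `|` b).
have anti c A A' : A `<=` A' -> acc c A' -> acc c A.
  by move=> AA' h b /(sub_chain AA')/h.
have [[D' [D'D pD' acc0]]|rej0] :=
    pselect (exists D', [/\ D' `<=` D, perfect D' & acc set0 D']).
  by exists D'; split=> //; left=> b /acc0; rewrite set0U.
pose rejects c A := forall U, U `<=` A -> perfect U -> ~ acc c U.
have rejects_anti c A A' : A `<=` A' -> rejects c A' -> rejects c A.
  by move=> AA' h U UA; apply: h; exact: subset_trans AA'.
(* First fusion: above each of its nodes [t], [T1] accepts or rejects every finite set of prefixes
   of [t]. *)
have [||T1 [T1D pT1 _ dec]] := @fusion_family _ (fun t => [set c | c `<=` below t])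
    (fun _ c A => acc c A \/ rejects c A) D finite_subsets_below _ _ pD.
- by move=> _ c A A' AA' [/(anti _ _ _ AA')|/(rejects_anti _ _ _ AA')]; [left|right].
- move=> t c E _ _ pE _.
  have [[U [UE pU aU]]|nU] :=
      pselect (exists U, [/\ U `<=` E, perfect U & acc c U]).
    by exists U; split=> //; left.
  by exists E; split=> //; right=> U UE pU aU; apply: nU; exists U.
pose rej t c := rejects c (T1 `&` above t).
have thin c E : E `<=` T1 -> perfect E -> (forall s, E s -> c `<=` below s) ->
    rejects c E ->
    exists E', [/\ E' `<=` E, perfect E' & forall s, E' s -> rej s (c `|` [set s])].
  move=> ET pE cE rE.
  (* If no [s] in [E'] gave a rejected set, then by [dec] each [c] with one node [s] of [E'] added
     would be accepted. Splitting a chain of [E'] at its least element [m] would then show that [E']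
     accepts [c]. *)
  have [E' [E'E pE' hE']] :=
    perfect_pigeonhole [set s | rej s (c `|` [set s])] pE.
  exists E'; split=> // s E's; case: hE' => [|hE']; first exact.
  case: (rE E' E'E pE') => b cb.
  have [bE' _ _] := cb; have [m bm mmin] := chain_min cb.
  have cm : c `|` [set m] `<=` below m.
    by move=> u [/(cE _ (E'E _ (bE' _ bm)))//|->]; exact: prefix_refl.
  have := dec m _ (ET _ (E'E _ (bE' _ bm))) cm; case=> [|/(hE' m (bE' _ bm))//].
  move=> /(_ (b `&` above m)).
  rewrite -setUA -(upto_min bm mmin) -(uptoU_above cb bm); apply.
  by apply: sub_chain (chain_above cb bm) => u [/E'E/ET].
have [|E0 [E0D pE0 hE0]] := thin set0 T1 (@subset_refl _ _) pT1 (fun _ _ => @sub0set _ _).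
  by move=> U UT pU aU; apply: rej0; exists U; split=> //; exact: subset_trans T1D.
have [||T2 [T2E pT2 _ hT2]] := @fusion_family _ (fun t => [set c | c `<=` below t])
    (fun t c A => rej t c -> forall s, A s -> rej s (c `|` [set s]))
    E0 finite_subsets_below _ _ pE0.
- by move=> t c A A' AA' h r s /AA'; exact: h.
- move=> t c E E0t ct pE EE0.
  have [r|nr] := pselect (rej t c); last by exists E; split.
  have [||||E' [E'E pE' hE']] := thin c E.
  + by move=> u /EE0[/E0D].
  + exact: pE.
  + by move=> u /EE0[_ tu] v /ct vt; exact: prefix_trans vt (strict_prefixW tu).
  + by apply: rejects_anti r => u /EE0[/E0D].
  by exists E'; split.
have rejected b : chain T2 b -> forall n s, (size s <= n)%N -> b s -> rej s (upto b s).
  move=> cb; have [bT _ _] := cb; elim=> [|n IH] s sn bs.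
    have [->|[t [_ /strict_prefix_size]]] := chain_pred cb bs; last first.
      by move=> /leq_trans/(_ sn).
    by rewrite -[X in rej _ X]set0U; apply: hE0; exact/T2E/bT.
  have [->|[t [bt ts ->]]] := chain_pred cb bs.
    by rewrite -[X in rej _ X]set0U; apply: hE0; exact/T2E/bT.
  apply: (hT2 t) => //; [exact: bT|exact: upto_below| |by split=> //; exact: bT].
  by apply: IH => //; rewrite -ltnS (leq_trans _ sn)//; exact: strict_prefix_size.
exists T2; split=> //; first by move=> u /T2E/E0D/T1D.
right=> b s cb bs Bs; have [bT _ _] := cb.
(* If [B] held at [upto b s], every continuation above [s] would hit [B] already at [s], so [T1]
   above [s] would accept a rejected set. *)
apply: (rejected _ cb _ _ (leqnn _) bs (T1 `&` above s) (@subset_refl _ _)).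
  by apply: perfect_above => //; exact/E0D/T2E/bT.
move=> b' [b'T _ _]; exists s; first by left; split=> //; exact: prefix_refl.
by rewrite uptoU_belowl//; [exact: upto_below|move=> u /b'T[]].
Qed.

(** * Ramsey theorem for analytic sets of chains *)

Lemma perfect_subtree D : perfect D -> exists2 T, T `<=` D & subtree T.
Proof.
move=> pD; have [//||T [TD _ sT _]] := @fusion (fun _ _ => True) D _ _ pD.
  by move=> t E _ pE _; exists E; split.
by exists T.
Qed.

Lemma upto_range (s : nat -> dyadic) n :
  {homo s : i j / (i < j)%N >-> strict_prefix i j} ->
  upto (range s) (s n) = [set s i | i in `I_n.+1].
Proof.
move=> sinc; apply/seteqP; split=> [_ [[i _ <-] h]|_ [i /= ni <-]].
  exists i => //=; rewrite ltnNge; apply: contraL h => /sinc.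
  exact: strict_prefix_asym.
split; first by exists i.
move: ni; rewrite ltnS leq_eqVlt => /orP[/eqP ->|/sinc/strict_prefixW//].
exact: prefix_refl.
Qed.

(* Every analytic set of chains is of the form
   [exists K `<=` b infinite, witness G b K], as in the Souslin operation. *)
Definition witness (G : set dyadic -> set dyadic -> Prop) (b K : set dyadic) :=
  forall s, K s -> G (upto b s) (upto K s).

(* [rej t a J] says that no perfect subset of [T1] above [t] excludes all
   witnesses continuing the finite pair [(a, J)]. By [open_ramsey], along every
   chain of [T2] a rejected pair is followed by a rejected pair with one more
   element in [J], and iterating this produces the witness. *)
Lemma analytic_ramsey (G : set dyadic -> set dyadic -> Prop) :
  exists2 T, subtree T &
    (forall b K, chain T b -> K `<=` b -> infinite_set K -> ~ witness G b K) \/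
    (forall b, chain T b -> exists K, [/\ K `<=` b, infinite_set K & witness G b K]).
Proof.
pose kill a J A := forall b K, chain A b -> K `<=` b -> infinite_set K ->
  ~ witness G (a `|` b) (J `|` K).
have anti a J A A' : A `<=` A' -> kill a J A' -> kill a J A.
  by move=> AA' h b K /(sub_chain AA'); exact: h.
have [[D [pD kD]]|rej0] :=
    pselect (exists D, perfect D /\ kill set0 set0 D).
  have [T TD sT] := perfect_subtree pD; exists T => //; left=> b K /(sub_chain TD) cb.
  by have := kD b K cb; rewrite !set0U.
pose rejects a J A := forall U, U `<=` A -> perfect U -> ~ kill a J U.
have rejects_anti a J A A' : A `<=` A' -> rejects a J A' -> rejects a J A.
  by move=> AA' h U UA; apply: h; exact: subset_trans AA'.
pose ix t := [set c | c `<=` below t] `*` [set c | c `<=` below t].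
have fix_ t : finite_set (ix t) by apply: finite_setX; exact: finite_subsets_below.
have [||T1 [_ pT1 _ dec]] := @fusion_family _ ix
    (fun _ c A => kill c.1 c.2 A \/ rejects c.1 c.2 A) setT fix_ _ _ perfectT.
- by move=> _ c A A' AA' [/(anti _ _ _ _ AA')|/(rejects_anti _ _ _ _ AA')]; [left|right].
- move=> t c E _ _ pE _.
  have [[U [UE pU aU]]|nU] :=
      pselect (exists U, [/\ U `<=` E, perfect U & kill c.1 c.2 U]).
    by exists U; split=> //; left.
  by exists E; split=> //; right=> U UE pU aU; apply: nU; exists U.
pose rej t a J := rejects a J (T1 `&` above t).
(* If [G a J] failed, no continuation of [(a, J)] above [s] could be a witness, since its traces up
   to [s] are [a] and [J]; so [T1] above [s] would kill the pair. *)
have rej_witness s a J : T1 s -> a `<=` below s -> J `<=` below s -> J s ->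
    rej s a J -> G a J.
  move=> Ts ab Jb Js; apply: contraPP => nG.
  move=> /(_ _ (@subset_refl _ _) (perfect_above pT1 Ts)); apply.
  move=> b K [bT _ _] Kb _ /(_ s (or_introl Js)).
  by rewrite !uptoU_belowl// => u => [/Kb|] /bT[].
pose next a J A := forall b, chain A b ->
  exists2 s, b s & rej s (a `|` upto b s) (J `|` [set s]).
have thin a J E : E `<=` T1 -> perfect E ->
    (forall s, E s -> a `<=` below s /\ J `<=` below s) -> rejects a J E ->
    exists E', [/\ E' `<=` E, perfect E' & next a J E'].
  move=> ET pE aJE rE.
  (* For an initial part [c] of a chain, the conditions [c s] and [c] below [s] say that [s] is the
     last element of [c]. *)
  have [E' [E'E pE' hE']] := open_ramsey
    (fun c => exists s, [/\ c s, c `<=` below s & rej s (a `|` c) (J `|` [set s])]) pE.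
  exists E'; split=> // [b cb]; case: hE' => hE'.
    have [s bs [t [[bt ts] st r]]] := hE' b cb; exists s => //.
    have [e|/strict_prefix_asym] := prefix_eqVstrict ts; first by move: r; rewrite e.
    by rewrite st//; split=> //; exact: prefix_refl.
  (* In the other alternative [E'] would kill [(a, J)]: given a witness [K] with least element [m],
     the pair extended up to [m] is either killed, against the rest of [K] being a witness for it,
     or rejected, against [hE']. *)
  exfalso; apply: (rE E' E'E pE') => {}b K {}cb Kb Kinf.
  have [bE' _ tot] := cb.
  have cK : chain E' K.
    by split=> //; [exact: subset_trans bE'|move=> u v /Kb bu /Kb bv; exact: tot].
  have [m Km mmin] := chain_min cK; have bm := Kb _ Km.
  have Em := E'E _ (bE' _ bm); have [am Jm] := aJE _ Em.
  have [||k|r] := dec m (a `|` upto b m, J `|` [set m]).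
  - exact: ET.
  - split=> u [|]; [exact: am|exact: upto_below|exact: Jm|move=> ->].
    exact: prefix_refl.
  - have := k (b `&` above m) (K `&` above m).
    rewrite -!setUA -(upto_min Km mmin) -(uptoU_above cb bm) -(uptoU_above cK Km); apply.
    + by apply: sub_chain (chain_above cb bm) => u [/E'E/ET].
    + by move=> u [/Kb].
    + exact: infinite_above cb bm Kb Kinf.
  - case: (hE' b m cb bm); exists m; split=> //; last exact: upto_below.
    by split=> //; exact: prefix_refl.
have [|E0 [E0T pE0 hE0]] := thin set0 set0 T1 (@subset_refl _ _) pT1
    (fun _ _ => conj (@sub0set _ _) (@sub0set _ _)).
  by move=> U UT pU aU; apply: rej0; exists U.
have [||T2 [T2E pT2 sT2 hT2]] := @fusion_family _ ix
    (fun t c A => rej t c.1 c.2 -> next c.1 c.2 A) E0 fix_ _ _ pE0.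
- by move=> t c A A' AA' h r b /(sub_chain AA'); exact: h.
- move=> t [a J] E E0t [/= at_ Jt] pE EE0.
  have [r|nr] := pselect (rej t a J); last by exists E; split.
  have [||||E' [E'E pE' hE']] := thin a J E.
  + by move=> u /EE0[/E0T].
  + exact: pE.
  + move=> u /EE0[_ /strict_prefixW tu].
    by split=> v => [/at_|/Jt] vt; exact: prefix_trans vt tu.
  + by apply: rejects_anti r => u /EE0[/E0T].
  by exists E'; split.
exists T2 => //; right=> b cb; have [bT _ tot] := cb.
(* [p.1] is the element of [b] chosen last and [p.2] the finite part of the witness built so far. *)
pose state (p : dyadic * set dyadic) :=
  [/\ b p.1, p.2 `<=` below p.1, p.2 p.1 & rej p.1 (upto b p.1) p.2].
have [s0 bs0] := hE0 b (sub_chain T2E cb); rewrite !set0U => r0.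
have /choice[nxt nxtP] : forall p, exists s, state p ->
    strict_prefix p.1 s /\ state (s, p.2 `|` [set s]).
  move=> [s J]; have [[/= bs Js Jss r]|n] := pselect (state (s, J)); last by exists s.
  have [||s' [bs' ss'] r'] := hT2 s (upto b s, J) (bT _ bs) _ r (b `&` above s).
  - by split=> //=; exact: upto_below.
  - exact: chain_above cb bs.
  exists s' => _; split=> //; split=> //=.
  - move=> u [/Js us|->]; last exact: prefix_refl.
    exact: prefix_trans us (strict_prefixW ss').
  - by right.
  - move: r'; rewrite /= (_ : _ `|` _ = upto b s')//.
    apply/seteqP; split=> [u [[bu us]|[[bu _] us']]|u [bu us']].
    + by split=> //; exact: prefix_trans us (strict_prefixW ss').
    + by split.
    + have : (upto b s `|` (b `&` above s)) u by rewrite -(uptoU_above cb bs).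
      by case=> [|[_ su]]; [left|right].
pose f := fix f n := if n is m.+1 then (nxt (f m), (f m).2 `|` [set nxt (f m)])
  else (s0, [set s0]).
have fP n : state (f n).
  elim: n => [|n /nxtP[]//].
  by split=> //= u ->; exact: prefix_refl.
pose s n := (f n).1.
have sS n : strict_prefix (s n) (s n.+1) by have [] := nxtP _ (fP n).
have sinc : {homo s : i j / (i < j)%N >-> strict_prefix i j}.
  move=> i; elim=> // j IH; rewrite ltnS leq_eqVlt => /orP[/eqP ->//|/IH h].
  exact: strict_prefix_trans (sS j).
(* The accumulated finite sets are the initial parts of the final [K], so [rej_witness] yields
   [witness] at every element of [K]. *)
have f2 n : (f n).2 = upto (range s) (s n).
  rewrite upto_range//; elim: n => [|n IH].
    by rewrite /= (_ : `I_1 = [set 0%N]) ?image_set1//; apply/seteqP; split=> -[].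
  rewrite [LHS]/= IH; apply/seteqP; split=> [_ [[i /= ni <-]|->]|_ [i /= + <-]].
  - by exists i => //=; exact: ltnW.
  - by exists n.+1 => //=.
  - by rewrite ltnS leq_eqVlt => /orP[/eqP ->|ni]; [right|left; exists i].
exists (range s); split.
- by move=> _ [n _ <-]; have [] := fP n.
- suff sinj : injective s.
    by rewrite (eq_finite_set (inj_card_eq (in2W sinj))); exact: infinite_nat.
  by move=> i j e; case: (ltngtP i j) => // /sinc; rewrite e strict_prefixxx.
- move=> _ [n _ <-]; rewrite -f2; have [bn J1 J2 r] := fP n.
  apply: rej_witness r => //; [exact/E0T/T2E/bT|exact: upto_below].
Qed.

(** * Compactness for coefficients with bounded partial sums *)

Section BanachSequences.
Variables (R : realType) (X : completeNormedModType R).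
Implicit Types (e : nat -> X) (l : nat -> R).

(** A compact interval provides a cluster point, and an ultrafilter converges to each of its cluster
    points. *)
Lemma ultra_bounded_cvg (F : set_system nat) (l : nat -> R) (M : R) :
  UltraFilter F -> (forall n, `|l n| <= M) -> exists p : R, l @ F --> p.
Proof.
move=> FU lM.
have [|p [_ clp]] := @segment_compact R (- M) M (l @ F) (fmap_proper_filter _ _).
  by apply: (@filterE _ F) => n; rewrite /= in_itv/= -ler_norml.
exists p => V Vp; have [//|nV] := in_ultra_setVsetC (l @^-1` V) FU.
by have [|x [+ /[dup]]] := clp (~` V) V _ Vp.
Qed.

(** The solution is a coordinatewise limit along an ultrafilter refining [\oo]; each inequality
    involves finitely many coordinates and is closed, so it passes to the limit. *)
Lemma partial_sum_compactness e (I : set nat) (d : R) :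
  (forall i, `|e i| = 1) ->
  (forall n, exists l,
    (forall m, (m <= n)%N -> `|\sum_(0 <= i < m.+1) l i *: e i| <= 1) /\
    (forall i, (i <= n)%N -> I i -> d <= `|l i|)) ->
  exists l, (forall m, `|\sum_(0 <= i < m.+1) l i *: e i| <= 1) /\
            (forall i, I i -> d <= `|l i|).
Proof.
move=> e1 /choice[L LP].
(* Each term is a difference of two partial sums of norm at most 1, or is itself the first partial
   sum. *)
have L2 n i : (i <= n)%N -> `|L n i| <= 2.
  move=> ni; have [Ls _] := LP n.
  suff : `|L n i *: e i| <= 1 + 1 by rewrite normrZ e1 mulr1.
  case: i ni => [|i] ni.
    have := Ls 0%N ni; rewrite big_nat1 => /le_trans; apply.
    by rewrite lerDl.
  rewrite (_ : _ *: _ = \sum_(0 <= j < i.+2) L n j *: e j -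
    \sum_(0 <= j < i.+1) L n j *: e j).
    by apply: le_trans (ler_normB _ _) _; apply: lerD; apply: Ls => //; exact: ltnW.
  by rewrite [X in _ = X - _]big_nat_recr//= addrAC subrr add0r.
have [F [FU oF]] := ultraFilterLemma eventually_filter.
(* Nothing bounds [L n i] for [n < i]; the value 0 there makes [L'] bounded and is invisible to
   [F]. *)
pose L' n i := if (i <= n)%N then L n i else 0.
have near_n i : \forall n \near F, (i <= n)%N.
  by apply: oF; exact: nbhs_infty_ge.
have /choice[l lP] : forall i, exists p : R, L' n i @[n --> F] --> p.
  move=> i; apply: (@ultra_bounded_cvg _ _ 2) => n; rewrite /L'.
  by case: ifP => [/L2//|_]; rewrite normr0.
have sumP m : \sum_(0 <= i < m) L' n i *: e i @[n --> F] --> \sum_(0 <= i < m) l i *: e i.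
  elim: m => [|m IH].
    by under eq_cvg do rewrite big_geq//; rewrite big_geq//; exact: cvg_cst.
  under eq_cvg do rewrite big_nat_recr//=.
  by rewrite big_nat_recr//=; apply: cvgD IH _; exact: cvgZr_tmp.
exists l; split=> [m|i Ii].
  apply: (closed_cvg _ (@closed_le R 1) _ _ (cvg_norm (sumP m.+1))).
  apply: filterS (near_n m) => n mn /=.
  rewrite (eq_big_nat _ _ (F2 := fun i => L n i *: e i)); first exact: (LP n).1.
  by move=> i /andP[_ im]; rewrite /L' (leq_trans _ mn).
apply: (closed_cvg _ (@closed_ge R d) _ _ (cvg_norm (lP i))).
apply: filterS (near_n i) => n mn /=; rewrite /L' mn.
exact: (LP n).2.
Qed.

(** A failure provides bounded partial sums whose coefficients do not tend to 0; dividing by a bound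
    [M] makes the bound 1. *)
Lemma not_semi_boundedly_completeP e :
  (forall i, `|e i| = 1) -> schauder_basic e ->
  ~ semi_boundedly_complete e <->
  exists l (d : R), [/\ 0 < d, forall m, `|\sum_(0 <= i < m.+1) l i *: e i| <= 1 &
    forall n, exists2 i, (n <= i)%N & d <= `|l i|].
Proof.
move=> e1 be; split=> [nsbc|[l [d [d0 l1 ld]]] [_ _ /(_ l)]]; last first.
  have sup1 : (ereal_sup (range (fun n =>
      `|\sum_(0 <= i < n.+1) l i *: e i|%:E)) < +oo)%E.
    apply: (@le_lt_trans _ _ 1%:E); last exact: ltry.
    by apply: ge_ereal_sup => _ [n _ <-]; rewrite lee_fin.
  move=> /(_ sup1)/cvgr0Pnorm_lt/(_ d d0)[n _ nP].
  by have [i ni] := ld n; rewrite leNgt nP.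
have [l [lsup nl]] : exists l : nat -> R,
    (ereal_sup (range (fun n => `|\sum_(0 <= i < n.+1) l i *: e i|%:E)) < +oo)%E /\
    ~ l @ \oo --> (0 : R).
  apply: contrapT => H; apply: nsbc; split=> // l lsup.
  by apply: contrapT => nl; apply: H; exists l.
have [d d0 ld] : exists2 d : R, 0 < d & forall n, exists2 i, (n <= i)%N & d <= `|l i|.
  apply: contrapT => H; apply/nl/cvgr0Pnorm_lt => d d0.
  apply: contrapT => H'; apply: H; exists d => // n.
  apply: contrapT => H; apply: H'; exists n => // i /= ni.
  by rewrite ltNge; apply/negP => h; apply: H; exists i.
have [M M0 lM] : exists2 M : R, 0 < M & forall m, `|\sum_(0 <= i < m.+1) l i *: e i| <= M.
  have ub m := ereal_sup_ubound (ex_intro2 _ _ m I erefl :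
    range (fun n => `|\sum_(0 <= i < n.+1) l i *: e i|%:E) _).
  case: (ereal_sup _) lsup ub => [r _ ub|//|_ /(_ 0%N)//].
  (* The maximum with 1 makes the bound positive, so that it can be divided by. *)
  exists (Num.max 1 r); first by rewrite lt_max ltr01.
  by move=> m; rewrite le_max -[_ <= r]lee_fin ub orbT.
exists (fun i => M^-1 * l i), (M^-1 * d); split.
- by rewrite mulr_gt0// invr_gt0.
- move=> m; under eq_bigr do rewrite -scalerA.
  by rewrite -scaler_sumr normrZ gtr0_norm ?invr_gt0// ler_pdivrMl// mulr1.
- move=> n; have [i ni di] := ld n; exists i => //.
  by rewrite normrM gtr0_norm ?invr_gt0// ler_pM2l// invr_gt0.
Qed.

End BanachSequences.

(** * Semi-bounded completeness along chains *)

Lemma upto_upto (b : set dyadic) s v : prefix v s -> upto (upto b s) v = upto b v.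
Proof.
move=> vs; apply/seteqP; split=> [u [[bu _] uv]|u [bu uv]] //.
by split=> //; split=> //; exact: prefix_trans vs.
Qed.

Lemma unbounded_infinite (I : set nat) :
  (forall n, exists2 i, (n <= i)%N & I i) -> infinite_set I.
Proof.
move=> h /finite_seqP[s Is]; have [i] := h (\max_(j <- s) j).+1.
rewrite ltnNge Is => /negP nle si; apply: nle.
exact: (@leq_bigmax_seq _ s xpredT id).
Qed.

Section ChainsInBanachSpace.
Variables (R : realType) (X : completeNormedModType R) (x : dyadic -> X).

(* Lowering the threshold from a fixed [d] to [1 / (size w).+1] for every
   [w] in [J] makes the condition independent of [d], at the cost of dropping
   finitely many elements of [J]. *)
Definition large_bounded (c J : set dyadic) : Prop :=
  exists l : dyadic -> R,
    (forall v, c v -> `|\sum_(w \in upto c v) l w *: x w| <= 1) /\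
    (forall v w, J v -> J w -> 1 <= `|l v| * (size w).+1%:R).

(** A witness may use different coefficients at each node of [K]; compactness glues them into one
    sequence. *)
Lemma chain_not_semi_boundedly_completeP (T b : set dyadic) :
  (forall s, `|x s| = 1) -> chain T b -> schauder_basic (along x b) ->
  ~ semi_boundedly_complete (along x b) <->
  exists K, [/\ K `<=` b, infinite_set K & witness large_bounded b K].
Proof.
move=> x1 cb sb; have := chain_enumP cb; set u := chain_enum b => -[uinc ub].
have usize i : (i <= size (u i))%N.
  elim: i => // i IH.
  exact: leq_ltn_trans IH (strict_prefix_size (uinc _ _ (ltnSn i))).
have uinj : injective u.
  by move=> i j e; case: (ltngtP i j) => // /uinc; rewrite e strict_prefixxx.
have ule i j : (i <= j)%N -> prefix (u i) (u j).
  rewrite leq_eqVlt => /orP[/eqP ->|/uinc/strict_prefixW//]; exact: prefix_refl.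
have bu i : b (u i) by rewrite -ub; exists i.
have uptob (f : dyadic -> X) m s : prefix (u m) s ->
    \sum_(w \in upto (upto b s) (u m)) f w = \sum_(0 <= i < m.+1) f (u i).
  move=> ms; rewrite upto_upto// -[in LHS]ub upto_range// fsbig_image.
    by rewrite -fsbig_ord big_mkord.
  by move=> i j _ _ /uinj.
apply: (iff_trans (not_semi_boundedly_completeP _ sb)); first by move=> i; exact: x1.
split=> [[l [d [d0 l1 ld]]]|[K [Kb Kinf wK]]].
  (* The second condition excludes only finitely many indices, since [size (u i)] is at least
     [i]. *)
  pose I := [set i | d <= `|l i| /\ 1 <= d * (size (u i)).+1%:R].
  exists (u @` I); split.
  - by move=> _ [i _ <-].
  - rewrite (eq_finite_set (inj_card_eq (in2W uinj))).
    apply: unbounded_infinite => n.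
    have [i] := ld (maxn n (Num.bound d^-1)).
    rewrite geq_max => /andP[ni di] dl; exists i => //; split=> //.
    rewrite -ler_pdivrMl// mulr1 ltW//.
    apply: lt_le_trans (archi_boundP _) _; first by rewrite invr_ge0 ltW.
    by rewrite ler_nat (leq_trans di)// (leq_trans (usize i)).
  (* [g] inverts [u], with value 0 off the chain, and transports coefficients from indices to
     nodes. *)
  - have /choice[g gP] : forall v, exists i, forall j, u j = v -> i = j.
      move=> v; have [[i ui]|n] := pselect (exists i, u i = v).
        by exists i => j; rewrite -ui => /uinj.
      by exists 0%N => j uj; case: n; exists j.
    have gu i : g (u i) = i by exact: gP.
    move=> s [n In us]; exists (l \o g); split=> [v [bv vs]|v w].
      have : range u v by rewrite ub.
      move=> [m _ mv]; rewrite -mv uptob; last by rewrite mv.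
      by under eq_bigr do rewrite /= gu; exact: l1.
    move=> [[i [Ii _] <-] _] [[j [_ Ij] <-] _] /=; rewrite gu.
    by apply: le_trans Ij _; rewrite ler_wpM2r.
have Kabove n : exists i, (n < i)%N /\ K (u i).
  have [s [Ks ns]] := infinite_setN0 (infinite_above cb (bu n) Kb Kinf).
  have : range u s by rewrite ub; exact: Kb.
  move=> [i _ ui]; exists i; rewrite ui; split=> //.
  rewrite ltnNge; apply/negP => /ule; rewrite ui.
  by apply/negP; exact: strict_prefix_asym.
have [i0 [_ Ki0]] := Kabove 0%N.
(* Fixing one node [u i0] of [K] gives a uniform threshold: take it as [w] in [large_bounded]. *)
have [||l [l1 ld]] := @partial_sum_compactness R X (along x b) [set i | K (u i)]
    ((size (u i0)).+1%:R^-1).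
- by move=> i; exact: x1.
(* The node [u k] of [K] lies beyond both [u n] and [u i0], so the coefficients attached to it serve
   all indices up to [n]. *)
- move=> n; have [k [+ Kk]] := Kabove (maxn n i0).
  rewrite gtn_max => /andP[nk ik].
  have [l [l1 ld]] := wK _ Kk; exists (l \o u); split=> [m mn|i ni Ki].
    have mk : prefix (u m) (u k) by apply/ule/(leq_trans mn)/ltnW.
    by rewrite -(uptob (fun w => l w *: x w) _ _ mk); apply: l1; split.
  have := ld (u i) (u i0); rewrite -ler_pdivrMr// mul1r; apply; split=> //; apply: ule.
    by apply/(leq_trans ni)/ltnW.
  exact: ltnW.
exists l, ((size (u i0)).+1%:R^-1); split=> //.
by move=> n; have [i [ni Ki]] := Kabove n; exists i; [exact: ltnW|exact: ld].
Qed.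

End ChainsInBanachSpace.

Unset Implicit Arguments.

Theorem theorem6p1 (R : realType) (X : completeNormedModType R)
    (x : dyadic -> X)
    (x_normalized : forall s : dyadic, `|x s| = 1)
    (x_basic : forall beta : set dyadic,
       chain [set: dyadic] beta -> schauder_basic (along x beta)) :
  exists T : set dyadic, subtree T /\
    ((forall beta : set dyadic,
        chain T beta -> semi_boundedly_complete (along x beta)) \/
     (forall beta : set dyadic,
        chain T beta -> ~ semi_boundedly_complete (along x beta))).
Proof.
have [T sT hT] := analytic_ramsey (large_bounded x).
(* Through this equivalence the two Ramsey alternatives become the two cases of the conclusion. *)
have key b : chain T b -> ~ semi_boundedly_complete (along x b) <->
    exists K, [/\ K `<=` b, infinite_set K & witness (large_bounded x) b K].
  move=> cb; apply: (chain_not_semi_boundedly_completeP x_normalized cb).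
  by apply: x_basic; exact: sub_chain cb.
exists T; split=> //; case: hT => hT; [left|right] => b cb; last exact/key/hT.
apply: contrapT => /(key b cb)[K [Kb Kinf]].
exact: hT cb Kb Kinf.
Qed.
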